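(* Let $u$ be a normalized and convex weight. Then the following are equivalent: (i) $H^{\infty}_{\underline{\mathcal U}_{\mathfrak c}}$ is closed under point-wise multiplication and the multiplication operator $\mathfrak m:(f,g)\mapsto f\cdot g$ acts continuously on this space (i.e. $\mathfrak m:H^{\infty}_{\underline{\mathcal U}_{\mathfrak c}}\times H^{\infty}_{\underline{\mathcal U}_{\mathfrak c}}\to H^{\infty}_{\underline{\mathcal U}_{\mathfrak c}}$ is continuous); (ii) $H^{\infty}_{\overline{\mathcal U}_{\mathfrak c}}$ is closed under point-wise multiplication and $\mathfrak m$ acts continuously on this space; (iii) $u$ is of moderate growth, i.e. there exists $H\ge1$ such that $u(Ht)\le e^Hu(t)^2$ for all $t\ge0$; (iv) the associated sequence $M^u$ satisfies: there exists $C\ge1$ such that $M^u_{j+k}\le C^{j+k}M^u_jM^u_k$ for all $j,k\in\mathbb{N}$.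
   Context: $\mathbb{N}=\{0,1,2,\dots\}$, $\mathbb{N}_{>0}=\{1,2,\dots\}$. A weight is a continuous, non-increasing function $v:[0,+\infty)\to(0,+\infty)$ with $\lim_{t\to+\infty}t^kv(t)=0$ for all $k\ge0$. It is normalized if $v(t)=1$ for all $t\in[0,1]$; convex if $t\mapsto-\log(v(e^t))$ is convex on $\mathbb{R}$. $H(\mathbb{C})$ is the space of entire functions and $H^{\infty}_v:=\{f\in H(\mathbb{C}):\|f\|_v:=\sup_{z\in\mathbb{C}}|f(z)|v(|z|)<+\infty\}$, a Banach space with norm $\|\cdot\|_v$. For $c>0$ let $u_c(t):=u(ct)$, and put $\underline{\mathcal U}_{\mathfrak c}:=(u_c)_{c\in\mathbb{N}_{>0}}$, $\overline{\mathcal U}_{\mathfrak c}:=(u_{1/c})_{c\in\mathbb{N}_{>0}}$. $H^{\infty}_{\underline{\mathcal U}_{\mathfrak c}}:=\varinjlim_{c\to\infty}H^{\infty}_{u_c}$ is the locally convex inductive limit (an (LB)-space; as a set the union), and $H^{\infty}_{\overline{\mathcal U}_{\mathfrak c}}:=\varprojlim_{c\to\infty}H^{\infty}_{u_{1/c}}$ is the projective limit (a Fréchet space; as a set the intersection). The sequence associated with $u$ is $M^u=(M^u_j)_{j\in\mathbb{N}}$, $M^u_j:=\sup_{t>0}t^ju(t)$. *)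

(* Defs.v *)
From HB Require Import structures.
From mathcomp Require Import all_boot all_order all_algebra.
From mathcomp Require Import complex.
From mathcomp Require Import all_classical all_reals all_analysis.

Set Implicit Arguments.
Unset Strict Implicit.
Unset Printing Implicit Defensive.

Import Order.TTheory GRing.Theory Num.Def Num.Theory.
Import numFieldNormedType.Exports.
Import Normc.

Local Open Scope classical_set_scope.
Local Open Scope ring_scope.

(* A weight lives on [0, +oo[; the values of [v] on ]-oo, 0[ are irrelevant
   junk and are not constrained by any of the definitions below. *)
Record is_weight (R : realType) (v : R -> R) : Prop := IsWeight {
  weight_continuous : {within `[0, +oo[, continuous v};
  weight_nonincr : forall s t, 0 <= s -> s <= t -> v t <= v s;
  weight_gt0 : forall t, 0 <= t -> 0 < v t;
  weight_decay : forall k : nat, t ^+ k * v t @[t --> +oo] --> 0 }.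

Record weight (R : realType) := Weight {
  weight_fun :> R -> R;
  weightP : is_weight weight_fun }.

Definition normalized (R : realType) (v : weight R) : Prop :=
  forall t, 0 <= t -> t <= 1 -> v t = 1.

Definition convex_weight (R : realType) (v : weight R) : Prop :=
  convex_function [set: R^o] (fun t : R^o => - ln (v (expR t)) : R^o).

Lemma dilate_is_weight (R : realType) (c : {posnum R}) (v : weight R) :
  is_weight (fun t => v (c%:num * t)).
Proof.
have [vc vn vp vd] := weightP v; split.
- have /continuous_within_itvcyP[vin v0] := vc.
  apply/continuous_within_itvcyP; split.
    move=> x; rewrite in_itv/= andbT => x0.
    apply: (@continuous_comp _ _ _ ( *%R c%:num) v); first exact: mulrl_continuous.
    by apply: vin; rewrite in_itv/= andbT mulr_gt0.
  rewrite mulr0; apply: cvg_comp v0 => A [e e0 eA]; exists (e / c%:num) => /=.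
    by rewrite divr_gt0.
  move=> x; rewrite /= sub0r normrN => xe x0; apply: eA; last by rewrite /= mulr_gt0.
  rewrite /= sub0r normrN gtr0_norm ?mulr_gt0//.
  by rewrite mulrC -ltr_pdivlMr// -[ltLHS]gtr0_norm.
- by move=> s t s0 st; apply: vn; rewrite ?mulr_ge0 ?ler_wpM2l.
- by move=> t t0; apply: vp; rewrite mulr_ge0.
- move=> k.
  have -> : (fun t => t ^+ k * v (c%:num * t)) =
      (fun t => (c%:num ^- k) * ((c%:num * t) ^+ k * v (c%:num * t))).
    by apply/funext => t; rewrite exprMn !mulrA mulVf ?mul1r// expf_neq0.
  rewrite -[X in _ --> X](mulr0 (c%:num ^- k)); apply: cvgMl_tmp.
  by apply: (cvg_comp _ _ _ (vd k)); apply: gt0_cvgMry => //; exact: cvg_id.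
Qed.

Definition dilate (R : realType) (c : {posnum R}) (v : weight R) : weight R :=
  Weight (dilate_is_weight c v).

Definition entire (R : realType) (f : R[i]^o -> R[i]^o) : Prop :=
  forall z, derivable f z 1.

Section weighted_space.
Variables (R : realType) (v : weight R).
Implicit Types f g : R[i]^o -> R[i]^o.

Definition wvalues f : set R := range (fun z => normc (f z) * v (normc z)).

Definition Hinf_pred : {pred R[i]^o -> R[i]^o} :=
  fun f => `[< entire f /\ has_ubound (wvalues f) >].

Lemma HinfP f : reflect (entire f /\ has_ubound (wvalues f)) (f \in Hinf_pred).
Proof. exact: asboolP. Qed.

Lemma normcD (x y : R[i]) : normc (x + y) <= normc x + normc y.
Proof. exact: (@le_normcD R). Qed.

Lemma normc_ge0 (x : R[i]) : 0 <= normc x.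
Proof. by case: x => a b; exact: sqrtr_ge0. Qed.

Lemma weight_normc_gt0 (z : R[i]) : 0 < v (normc z).
Proof. by apply: (weight_gt0 (weightP v)); exact: normc_ge0. Qed.

Lemma Hinf_submod : submod_closed Hinf_pred.
Proof.
split.
  apply/HinfP; split; first by move=> z; exact: derivable_cst.
  by exists 0 => _ [z _ <-]; rewrite [(0 : _ -> _) z]/(0 : R[i]) normc0 mul0r.
move=> a f g /HinfP[ef [M fM]] /HinfP[eg [N gN]]; apply/HinfP; split.
  by move=> z; apply: derivableD => //; exact: derivableZ.
exists (normc a * M + N) => _ [z _ <-].
apply: (@le_trans _ _ ((normc (a * f z) + normc (g z)) * v (normc z))).
  by rewrite ler_wpM2r ?normcD// ltW// weight_normc_gt0.
rewrite mulrDl normcM -mulrA lerD//; last by apply: gN; exists z.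
by rewrite ler_wpM2l ?normc_ge0//; apply: fM; exists z.
Qed.

HB.instance Definition _ :=
  GRing.isSubmodClosed.Build R[i] (R[i]^o -> R[i]^o) Hinf_pred Hinf_submod.

Definition Hinf := {f : R[i]^o -> R[i]^o | f \in Hinf_pred}.

HB.instance Definition _ := SubType.on Hinf.
HB.instance Definition _ := Choice.on Hinf.
HB.instance Definition _ := [SubChoice_isSubLmodule of Hinf by <:].

End weighted_space.

Section weighted_norm.
Variables (R : realType) (v : weight R).
Local Notation Hinf := (Hinf v).
Implicit Types f g : Hinf.

Definition wnorm (f : Hinf) : R := sup (wvalues v (val f)).

Lemma wvalues_has_sup (f : Hinf) : has_sup (wvalues v (val f)).
Proof.
split; last by have /HinfP[] := valP f.
by exists (normc (val f 0) * v (normc 0)), 0.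
Qed.

Lemma le_wnorm (f : Hinf) z : normc (val f z) * v (normc z) <= wnorm f.
Proof. by apply: ub_le_sup; [case: (wvalues_has_sup f)|exists z]. Qed.

Lemma wnorm_le (f : Hinf) (M : R) :
  (forall z, normc (val f z) * v (normc z) <= M) -> wnorm f <= M.
Proof.
move=> fM; apply: ge_sup; first by case: (wvalues_has_sup f).
by move=> _ [z _ <-].
Qed.

Lemma wnorm_ge0 f : 0 <= wnorm f.
Proof.
by apply: le_trans (le_wnorm f 0); rewrite mulr_ge0 ?normc_ge0// ltW// weight_normc_gt0.
Qed.

Lemma wnormD f g : wnorm (f + g) <= wnorm f + wnorm g.
Proof.
apply: wnorm_le => z.
apply: le_trans (lerD (le_wnorm f z) (le_wnorm g z)).
by rewrite -mulrDl ler_wpM2r ?normcD// ltW// weight_normc_gt0.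
Qed.

Lemma wnormZ_le (l : R[i]) f : wnorm (l *: f) <= normc l * wnorm f.
Proof.
apply: wnorm_le => z; rewrite -[val _ z]/(l * val f z) normcM -mulrA.
by rewrite ler_wpM2l ?normc_ge0// le_wnorm.
Qed.

Lemma wnormZ (l : R[i]) f : wnorm (l *: f) = normc l * wnorm f.
Proof.
apply/eqP; rewrite eq_le wnormZ_le/=.
have [->|l0] := eqVneq l 0; first by rewrite normc0 mul0r wnorm_ge0.
have nl0 : 0 < normc l.
  by rewrite lt_neqAle normc_ge0 andbT eq_sym; apply: contra l0 => /eqP/eq0_normc->.
rewrite -ler_pdivlMl// -normcV; apply: le_trans (wnormZ_le _ _).
by rewrite scalerA mulVf// scale1r.
Qed.

Lemma wnorm0_eq0 f : wnorm f = 0 -> f = 0.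
Proof.
move=> f0; apply/val_inj/funext => z; apply: eq0_normc; apply/eqP.
rewrite eq_le normc_ge0 andbT -(@pmulr_lle0 _ (v (normc z))) ?weight_normc_gt0//.
by rewrite (le_trans (le_wnorm f z))// f0.
Qed.

(* The library requires the norm of a complex normed space to take its values
   in the scalar field R[i]; it is the real number [wnorm f]. *)
Let cnorm (f : Hinf) : R[i] := (wnorm f)%:C%C.

Let cnormD f g : cnorm (f + g) <= cnorm f + cnorm g.
Proof. by rewrite /cnorm -rmorphD/= lecR wnormD. Qed.

Let cnormZ (l : R[i]) f : cnorm (l *: f) = `|l| * cnorm f.
Proof. by rewrite /cnorm wnormZ rmorphM. Qed.

Let cnorm0_eq0 f : cnorm f = 0 -> f = 0.
Proof. by case=> /wnorm0_eq0. Qed.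

HB.instance Definition _ :=
  Lmodule_isNormed.Build R[i] Hinf cnormD cnormZ cnorm0_eq0.

End weighted_norm.

Section inductive_limit.
Variables (R : realType) (u : weight R).

(* Families indexed by c = 1, 2, ... are shifted to start at [c = 0]. *)
Definition ind_step (c : nat) : weight R := dilate (c.+1%:R : R)%:pos u.

Definition Hind_pred : {pred R[i]^o -> R[i]^o} :=
  fun f => `[< exists c, f \in Hinf_pred (ind_step c) >].

Lemma HindP f : reflect (exists c, f \in Hinf_pred (ind_step c)) (f \in Hind_pred).
Proof. exact: asboolP. Qed.

Lemma ind_step_sub (c d : nat) : (c <= d)%N ->
  {subset Hinf_pred (ind_step c) <= Hinf_pred (ind_step d)}.
Proof.
move=> cd f /HinfP[ef [M fM]]; apply/HinfP; split=> //; exists M => _ [z _ <-].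
apply: le_trans (fM _ _); last by exists z.
rewrite ler_wpM2l ?normc_ge0//; apply: (weight_nonincr (weightP u)).
  by rewrite mulr_ge0 ?normc_ge0.
by rewrite ler_wpM2r ?normc_ge0//= ler_nat ltnS.
Qed.

Lemma Hind_submod : submod_closed Hind_pred.
Proof.
split; first by apply/HindP; exists 0; exact: (rpred0 (Hinf_pred _)).
move=> a f g /HindP[c fc] /HindP[d gd]; apply/HindP; exists (maxn c d).
have fm := ind_step_sub (leq_maxl c d) fc.
have gm := ind_step_sub (leq_maxr c d) gd.
by case: (Hinf_submod (ind_step (maxn c d))) => _; exact.
Qed.

HB.instance Definition _ :=
  GRing.isSubmodClosed.Build R[i] (R[i]^o -> R[i]^o) Hind_pred Hind_submod.

Definition Hind := {f : R[i]^o -> R[i]^o | f \in Hind_pred}.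

HB.instance Definition _ := SubType.on Hind.
HB.instance Definition _ := Choice.on Hind.
HB.instance Definition _ := [SubChoice_isSubLmodule of Hind by <:].

Definition ind_incl (c : nat) (f : Hinf (ind_step c)) : Hind :=
  Sub (val f) (asboolT (ex_intro _ c (valP f))).

Definition absolutely_convex (V : set Hind) : Prop :=
  forall (a b : R[i]) f g, `|a| + `|b| <= 1 -> V f -> V g -> V (a *: f + b *: g).

(* The absolutely convex sets whose trace on every step is a 0-neighbourhood:
   a 0-neighbourhood base of the locally convex inductive limit. *)
Definition ind_nbhs0 (V : set Hind) : Prop :=
  absolutely_convex V /\
  forall c, nbhs (0 : Hinf (ind_step c)) (@ind_incl c @^-1` V).

Definition ind_nbhs (f : Hind) : set_system Hind :=
  [set U | exists2 V, ind_nbhs0 V & forall g, V g -> U (f + g)].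

End inductive_limit.

Fact scaler_half (K : numFieldType) (L : lmodType K) (f : L) :
  2^-1 *: (2 *: f) = f.
Proof. by rewrite scalerA mulVf ?scale1r// pnatr_eq0. Qed.

Fact norm_half (K : numFieldType) : `|2^-1 : K| + `|2^-1 : K| <= 1.
Proof. by rewrite ger0_norm ?invr_ge0// -[2^-1]mul1r -splitr. Qed.

Fact mulr2_frac (K : numFieldType) (x y : K) :
  y != 0 -> 2 * x = x / y * (2 * y).
Proof. by move=> y0; rewrite mulrACA mulVf// mulr1 mulrC. Qed.

Section inductive_limit_topology.
Variables (R : realType) (u : weight R).
Local Notation Hind := (Hind u).
Implicit Types (f g : Hind) (U V W : set Hind).

Lemma ind_incl_scale c a (f : Hinf (ind_step u c)) :
  ind_incl (a *: f) = a *: ind_incl f.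
Proof. exact/val_inj. Qed.

Lemma ind_incl0 c : ind_incl (0 : Hinf (ind_step u c)) = 0.
Proof. exact/val_inj. Qed.

Lemma ind_nbhs0_0 V : ind_nbhs0 V -> V 0.
Proof. by move=> [_ /(_ 0%N)/nbhs_singleton/=]; rewrite ind_incl0. Qed.

Lemma ind_nbhs0T : ind_nbhs0 [set: Hind].
Proof. by split=> // c; rewrite preimage_setT; exact: filterT. Qed.

Lemma ind_nbhs0I V W : ind_nbhs0 V -> ind_nbhs0 W -> ind_nbhs0 (V `&` W).
Proof.
move=> [aV nV] [aW nW]; split.
  by move=> a b f g ab [Vf Wf] [Vg Wg]; split; [exact: aV|exact: aW].
by move=> c; rewrite preimage_setI; apply: filterI; [exact: nV|exact: nW].
Qed.

Lemma ind_nbhs0Z (a : R[i]) V :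
  ind_nbhs0 V -> ind_nbhs0 [set f | V (a *: f)].
Proof.
move=> [aV nV]; split.
  move=> x y f g xy Vf Vg /=.
  by rewrite scalerDr !scalerA ![a * _]mulrC -!scalerA; exact: aV.
move=> c; have : (fun f : Hinf (ind_step u c) => a *: f) @ 0 --> (0 : Hinf _).
  by rewrite -[X in _ --> X](scaler0 _ a); exact: (@scaler_continuous _ _ a 0).
move=> /(_ _ (nV c)) h; apply: (@filterS _ (nbhs (0 : Hinf (ind_step u c))) _ _ _ _ h).
by move=> f /=; rewrite ind_incl_scale.
Qed.

Lemma ind_nbhs0_balanced V a f : ind_nbhs0 V -> `|a| <= 1 -> V f -> V (a *: f).
Proof.
move=> [aV _] a1 Vf; rewrite -[a *: f]addr0 -[X in _ + X](scale0r f).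
by apply: aV => //; rewrite normr0 addr0.
Qed.

Lemma ind_nbhs0_half V f g :
  ind_nbhs0 V -> V (2 *: f) -> V (2 *: g) -> V (f + g).
Proof.
move=> [aV _] Vf Vg.
have -> : f + g = 2^-1 *: (2 *: f) + 2^-1 *: (2 *: g).
  by rewrite !scaler_half.
by apply: aV => //; exact: norm_half.
Qed.

Lemma ind_nbhs0_absorbing V f : ind_nbhs0 V ->
  exists2 e : R[i], 0 < e & forall a, `|a| <= e -> V (a *: f).
Proof.
move=> [_ nV]; have /HindP[c fc] := valP f.
pose f' : Hinf (ind_step u c) := Sub (val f) fc.
have -> : f = ind_incl f' by exact/val_inj.
have : (fun a : R[i]^o => a *: f') @ 0 --> (0 : Hinf _).
  rewrite -[X in _ --> X](scale0r f').
  exact: (@scalel_continuous _ _ f' 0).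
move=> /(_ _ (nV c)) /nbhs_norm0P[e /= e0 eV].
exists (e / 2); first by rewrite divr_gt0.
move=> a ae; rewrite -ind_incl_scale; apply: eV => /=.
by apply: le_lt_trans ae _; rewrite gtr_pMr// invf_lt1// ltr1n.
Qed.

Lemma ind_nbhs_shift V f : ind_nbhs0 V -> ind_nbhs f [set g | V (g - f)].
Proof. by move=> nV; exists V => // g Vg /=; rewrite addrC addKr. Qed.

Let ind_nbhs_filter f : ProperFilter (ind_nbhs f).
Proof.
apply: Build_ProperFilter_ex.
  by move=> U [V nV VU]; exists (f + 0); exact: VU (ind_nbhs0_0 nV).
split.
- by exists setT => //; exact: ind_nbhs0T.
- move=> U U' [V nV VU] [V' nV' VU']; exists (V `&` V').
    exact: ind_nbhs0I.
  by move=> g [Vg V'g]; split; [exact: VU|exact: VU'].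
- by move=> U U' UU' [V nV VU]; exists V => // g /VU /UU'.
Qed.

Let ind_nbhs_singleton f U : ind_nbhs f U -> U f.
Proof. by move=> [V nV VU]; rewrite -[f]addr0; exact: VU (ind_nbhs0_0 nV). Qed.

Let ind_nbhs_nbhs f U : ind_nbhs f U -> ind_nbhs f ((@ind_nbhs _ u)^~ U).
Proof.
move=> [V nV VU]; exists [set g | V (2 *: g)]; first exact: ind_nbhs0Z.
move=> g Vg; exists [set g | V (2 *: g)]; first exact: ind_nbhs0Z.
by move=> h Vh; rewrite -addrA; exact: VU (ind_nbhs0_half nV Vg Vh).
Qed.

HB.instance Definition _ := hasNbhs.Build Hind (@ind_nbhs _ u).
HB.instance Definition _ := Nbhs_isNbhsTopological.Build Hind
  ind_nbhs_filter ind_nbhs_singleton ind_nbhs_nbhs.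

Let ind_add_continuous : continuous (fun fg : Hind * Hind => fg.1 + fg.2).
Proof.
move=> [f g] /= U [V nV VU].
have n2 := ind_nbhs0Z 2 nV.
exists ([set h | V (2 *: (h - f))], [set h | V (2 *: (h - g))]) => /=.
  by split; exact: (ind_nbhs_shift _ n2).
move=> [h k] /= [Vh Vk]; have := VU _ (ind_nbhs0_half nV Vh Vk).
by rewrite addrACA [f + _]addrC addrNK [g + _]addrC addrNK.
Qed.

Let ind_scale_continuous :
  continuous (fun af : R[i]^o * Hind => af.1 *: af.2).
Proof.
move=> [a f] /= U [V nV VU].
have [e e0 eV] := ind_nbhs0_absorbing f nV.
have a1 : 0 < `|a| + 1 by rewrite ltr_wpDl.
pose b : R[i] := 2 * (`|a| + 1).
exists (ball a 1 `&` ball a (e / 2), [set h | V (b *: (h - f))]) => /=.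
  split; last exact: (ind_nbhs_shift _ (ind_nbhs0Z b nV)).
  by apply: filterI; apply: nbhsx_ballx => //; rewrite divr_gt0.
move=> [x h] /= []; rewrite -!ball_normE/= => -[xa1 xae] Vh.
rewrite (_ : x *: h = a *: f + (x *: (h - f) + (x - a) *: f)); last first.
  by rewrite scalerBr scalerBl [RHS]addrC addrA !subrK.
apply: VU; apply: ind_nbhs0_half => //.
- have -> : 2 *: (x *: (h - f)) = (x / (`|a| + 1)) *: (b *: (h - f)).
    by rewrite !scalerA; congr (_ *: _); apply: mulr2_frac; rewrite gt_eqF.
  apply: (ind_nbhs0_balanced nV) => //.
  rewrite normrM normfV (gtr0_norm a1) ler_pdivrMr// mul1r.
  rewrite -[x](subrK a) addrC (le_trans (ler_normD _ _))// lerD2l distrC.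
  exact: ltW.
- rewrite scalerA; apply: eV; rewrite normrM ger0_norm// distrC.
  by rewrite mulrC -ler_pdivlMr// ltW.
Qed.

Let ind_locally_convex : exists2 B : set_system Hind,
  (forall b, b \in B -> convex_set b) & basis B.
Proof.
exists [set O : set Hind | open O /\ convex_set O].
  by move=> O; rewrite inE => [[_ Oc]].
split; first by move=> O [].
move=> f U [V nV VU].
exists (interior [set g | V (g - f)]); last first.
  move=> g /interior_subset/= Vg.
  by rewrite -[g](subrK f) addrC; exact: VU.
split; last exact: ind_nbhs_shift.
split; first exact: open_interior.
move=> g h l; rewrite !inE => -[V1 n1 V1U] [V2 n2 V2U].
exists (V1 `&` V2); first exact: ind_nbhs0I.
move=> k [/V1U/= Vg /V2U/= Vh].
rewrite [X in X + k - f]/(conv _ _ _)/=.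
have l01 : `|l%:num| + `|1 - l%:num| <= 1.
  by rewrite !ger0_norm ?subr_ge0// addrC subrK.
rewrite (_ : _ - f = l%:num *: (g + k - f) + (1 - l%:num) *: (h + k - f)).
  by case: nV => + _; apply.
rewrite -!addrA [_ *: (g + _)]scalerDr [_ *: (h + _)]scalerDr [RHS]addrACA -[_ *: (k - f) + _]scalerDl [l%:num + _]addrC.
by rewrite subrK scale1r addrA.
Qed.

(* This factory only yields the uniform structure, hence the three instances
   that follow it. *)
HB.instance Definition _ := PreTopologicalLmod_isTvs.Build R[i] Hind
  ind_add_continuous ind_scale_continuous ind_locally_convex.
HB.instance Definition _ :=
  PreTopologicalNmodule_isTopologicalNmodule.Build Hind ind_add_continuous.
HB.instance Definition _ :=
  TopologicalNmodule_isTopologicalLmodule.Build R[i] Hind ind_scale_continuous.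
HB.instance Definition _ := Uniform_isTvs.Build R[i] Hind ind_locally_convex.

Lemma ind_incl_continuous c : continuous (@ind_incl _ u c).
Proof.
move=> f U [V [_ nV] VU]; apply/(@nbhs0P _ (Hinf (ind_step u c))).
apply: filterS (nV c) => g /= /VU.
by congr (U _); exact/val_inj.
Qed.

End inductive_limit_topology.

Section projective_limit.
Variables (R : realType) (u : weight R).

Definition proj_step (c : nat) : weight R := dilate (c.+1%:R^-1 : R)%:pos u.

Definition Hproj_pred : {pred R[i]^o -> R[i]^o} :=
  fun f => `[< forall c, f \in Hinf_pred (proj_step c) >].

Lemma HprojP f :
  reflect (forall c, f \in Hinf_pred (proj_step c)) (f \in Hproj_pred).
Proof. exact: asboolP. Qed.

Definition Hproj := {f : R[i]^o -> R[i]^o | f \in Hproj_pred}.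

HB.instance Definition _ := SubType.on Hproj.
HB.instance Definition _ := Choice.on Hproj.

Definition proj_diag (f : Hproj) : prod_topology (fun c => Hinf (proj_step c)) :=
  fun c => Sub (val f) (asboolW (valP f) c).

(* The topology of the projective limit: the one induced by the product of the
   Banach spaces of the projective spectrum. *)
HB.instance Definition _ := Topological.copy Hproj (initial_topology proj_diag).

End projective_limit.

Section multiplication.
Variables (R : realType) (P : {pred R[i]^o -> R[i]^o}).

Definition mul_closed : Prop := {in P &, forall f g, f \* g \in P}.

Definition mul_op (mP : mul_closed) (fg : {f | f \in P} * {f | f \in P}) :
    {f | f \in P} :=
  exist _ (val fg.1 \* val fg.2) (mP _ _ (valP fg.1) (valP fg.2)).

End multiplication.

Definition moderate_growth (R : realType) (v : weight R) : Prop :=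
  exists2 H : R, 1 <= H & forall t, 0 <= t -> v (H * t) <= expR H * v t ^+ 2.

Definition assoc_seq (R : realType) (v : weight R) (j : nat) : R :=
  sup [set t ^+ j * v t | t in [set t | 0 < t]].

(* Main.v *)
Require Import Defs.
From mathcomp Require Import all_boot all_order all_algebra.
From mathcomp Require Import complex.
From mathcomp Require Import all_classical all_reals all_analysis.
From mathcomp Require Import ring lra.

(** Write M_j for the associated sequence sup t^j u(t).

    The two conditions on the weight are linked by elementary estimates.
    Moderate growth gives the condition on M by substituting t = H s in the
    supremum ([moderate_growth_assoc_seq_mg]). The converse is the only place
    where convexity enters: it makes every t^j u(t) quasiconcave in t
    ([convex_weight_quasiconcave]), so that for each t > 1 with u(t) < 1 there
    is an integer j whose supremum M_j is nearly attained at t, namely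
    M_j <= t^(j+1) u(t) ([assoc_seq_near_optimal]). Then
    u(H t) <= M_(2j+2) / (H t)^(2j+2), the growth of M bounds M_(2j+2) by
    M_2 M_j^2 up to a geometric factor, and a large H absorbs that factor
    ([assoc_seq_mg_moderate_growth]).

    Moderate growth makes multiplication continuous because it bounds
    u(H max(s, t)) by e^H u(s) u(t): the product of two functions weighted by
    dilates of u is weighted by a further dilate, with a norm estimate. On the
    Frechet space this estimate is continuity. On the inductive limit one has
    to find, for an absolutely convex 0-neighbourhood V, another one W with
    W W contained in V. The absolutely convex hull of suitably small balls of
    the steps works: the step in which the product of two balls lands depends
    on the larger of their indices alone, so each radius has to be adapted to
    one receiving step only ([ind_nbhs0_mul]).

    Conversely, if the condition on M fails, then there are exponents j_m, k_m
    for which M_(j+k) exceeds M_j M_k by a factor (m+1)^(2(j+k+1)). The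
    monomials z^j / ((m+1)^(j+1) M_j) and z^k / ((m+1)^(k+1) M_k) tend to zero
    in both spaces, but their product does not: it is larger than
    1 / u((m+1) t_m) at some point t_m ([not_assoc_seq_mg]). In the projective
    limit this contradicts convergence to zero in the first step. In the
    inductive limit it contradicts convergence to zero because the functions h
    with |h(t_m)| <= 1 / u((m+1) t_m) for all m form a 0-neighbourhood
    ([ind_nbhs0_spike_set]). *)

Set Implicit Arguments.
Unset Strict Implicit.
Unset Printing Implicit Defensive.

Import Order.TTheory GRing.Theory Num.Def Num.Theory.
Import numFieldNormedType.Exports.
Import Normc.

Local Open Scope classical_set_scope.
Local Open Scope ring_scope.

(** * Weights of moderate growth and the associated sequence *)

Section associated_sequence.
Variables (R : realType) (u : weight R).
Local Notation M := (assoc_seq u).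

Lemma assoc_seq_ubound j : has_ubound [set t ^+ j * u t | t in [set t | 0 < t]].
Proof.
have /cvgr0Pnorm_lt/(_ 1 ltr01) := weight_decay (weightP u) j.
move=> [T [_ uT]]; exists (Num.max 1 (`|T| ^+ j * u 0)) => _ /= [t t0 <-].
rewrite le_max; have [Tt|tT] := ltP T t.
  by rewrite (le_trans (ler_norm _))// ltW//; exact: uT.
apply/orP; right; apply: ler_pM.
- by rewrite exprn_ge0// ltW.
- by rewrite ltW// (weight_gt0 (weightP u))// ltW.
- by rewrite lerXn2r ?nnegrE ?(ltW t0)// (le_trans tT)// ler_norm.
- by apply: (weight_nonincr (weightP u)) => //; exact: ltW.
Qed.

Lemma le_assoc_seq j t : 0 < t -> t ^+ j * u t <= M j.
Proof. by move=> t0; apply: ub_le_sup; [exact: assoc_seq_ubound|exists t]. Qed.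

Lemma assoc_seq_le j A : (forall t, 0 < t -> t ^+ j * u t <= A) -> M j <= A.
Proof.
move=> uA; apply: ge_sup; first by exists (1 ^+ j * u 1), 1 => /=.
by move=> _ [t t0 <-]; exact: uA.
Qed.

Lemma assoc_seq_gt j A :
  A < M j -> exists2 t, 0 < t & A < t ^+ j * u t.
Proof.
move=> AM; have [|_ [t t0 <-]] := sup_gt _ AM; last by exists t.
by exists (1 ^+ j * u 1), 1 => /=.
Qed.

Section normalized.
Hypothesis u_normalized : normalized u.

Lemma weight_le1 t : 0 <= t -> u t <= 1.
Proof.
move=> t0; rewrite -(u_normalized (lexx 0) ler01).
exact: (weight_nonincr (weightP u)).
Qed.

Lemma assoc_seq_ge1 j : 1 <= M j.
Proof.
by have := le_assoc_seq j ltr01; rewrite expr1n mul1r u_normalized ?ler01.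
Qed.

Lemma assoc_seq_gt0 j : 0 < M j.
Proof. exact: lt_le_trans (assoc_seq_ge1 j). Qed.

Lemma assoc_seq0 : M 0 = 1.
Proof.
apply/eqP; rewrite eq_le assoc_seq_ge1 andbT; apply: assoc_seq_le => t t0.
by rewrite mul1r weight_le1// ltW.
Qed.

Lemma le_assoc_seq_ge0 j t : 0 <= t -> t ^+ j * u t <= M j.
Proof.
rewrite le_eqVlt => /orP[/eqP<-|]; last exact: le_assoc_seq.
rewrite u_normalized// mulr1 (le_trans _ (assoc_seq_ge1 j))//.
by rewrite expr0n lern1 leq_b1.
Qed.

Definition assoc_seq_mg : Prop :=
  exists2 C : R, 1 <= C &
    forall j k : nat, M (j + k)%N <= C ^+ (j + k) * M j * M k.

(** The constant A is absorbed into the geometric factor, except for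
    j = k = 0, where normalization gives M_0 = 1. *)
Lemma assoc_seq_mg_const A C : 1 <= A -> 1 <= C ->
  (forall j k, M (j + k)%N <= A * C ^+ (j + k) * M j * M k) -> assoc_seq_mg.
Proof.
move=> A1 C1 AC; exists (A * C); first by rewrite mulr_ege1.
have M0 := assoc_seq_gt0.
move=> j k; have [/eqP|n0] := posnP (j + k).
  by rewrite addn_eq0 => /andP[/eqP-> /eqP->]; rewrite assoc_seq0 !mulr1.
apply: le_trans (AC j k) _.
rewrite !ler_wpM2r ?(ltW (M0 _))// exprMn ler_wpM2r ?exprn_ge0//.
  exact: le_trans C1.
by rewrite -[leLHS]expr1 ler_weXn2l.
Qed.

Lemma moderate_growth_assoc_seq_mg : moderate_growth u -> assoc_seq_mg.
Proof.
move=> [H H1 uH]; have H0 := lt_le_trans ltr01 H1.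
apply: (@assoc_seq_mg_const (expR H) H) => //; first by apply: le_trans (expR_ge1Dx H); rewrite lerDl ltW.
move=> j k; apply: assoc_seq_le => t t0; pose s := t / H.
have s0 : 0 < s by rewrite divr_gt0.
have -> : t = H * s by rewrite /s mulrCA divff ?mulr1// gt_eqF.
have us0 : 0 < u s by rewrite (weight_gt0 (weightP u))// ltW.
have Hs0 : 0 <= (H * s) ^+ (j + k) by apply/exprn_ge0/ltW/mulr_gt0.
apply: le_trans (ler_wpM2l Hs0 (uH s (ltW s0))) _.
have -> : (H * s) ^+ (j + k) * (expR H * u s ^+ 2) =
    expR H * H ^+ (j + k) * ((s ^+ j * u s) * (s ^+ k * u s)).
  by rewrite exprMn [s ^+ (_ + _)]exprD; ring.
rewrite -[leRHS]mulrA ler_wpM2l ?mulr_ge0 ?exprn_ge0 ?expR_ge0 ?(ltW H0)//.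
by apply: ler_pM; rewrite ?le_assoc_seq ?mulr_ge0 ?exprn_ge0 ?(ltW s0) ?(ltW us0).
Qed.

Section convex.
Hypothesis u_convex : convex_weight u.

(** In the variable ln t, the logarithm of t^j u(t) is the linear function with
    slope j plus a concave function. *)
Lemma convex_weight_quasiconcave j a b c : 0 < a -> a < b -> b < c ->
  minr (a ^+ j * u a) (c ^+ j * u c) <= b ^+ j * u b.
Proof.
move=> a0 ab bc; have b0 := lt_trans a0 ab; have c0 := lt_trans b0 bc.
have u0 t : 0 < t -> 0 < u t by move=> t0; rewrite (weight_gt0 (weightP u))// ltW.
pose w t := t ^+ j * u t; rewrite -[b ^+ j * _]/(w b).
have w0 t : 0 < t -> 0 < w t by move=> t0; rewrite mulr_gt0 ?exprn_gt0 ?u0.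
have lnw t : 0 < t -> ln (w t) = j%:R * ln t + ln (u t).
  move=> t0; rewrite lnM ?posrE ?exprn_gt0 ?u0// lnXn ?mulr_natl//.
have lab : ln a < ln b by rewrite ltr_ln.
have lbc : ln b < ln c by rewrite ltr_ln.
have lac := lt_trans lab lbc.
pose l := (ln c - ln b) / (ln c - ln a).
have d0 : 0 < ln c - ln a by rewrite subr_gt0.
have l0 : 0 <= l by rewrite divr_ge0 ?subr_ge0 ?ltW.
have l1 : l <= 1 by rewrite ler_pdivrMr// mul1r lerD2l lerN2 ltW.
pose p : {i01 R} := Itv01 l0 l1.
have blac : ln b = l * ln a + (1 - l) * ln c.
  by rewrite /l; field; rewrite gt_eqF.
have : - ln (u (expR (l * ln a + (1 - l) * ln c))) <=
    l * - ln (u (expR (ln a))) + (1 - l) * - ln (u (expR (ln c))).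
  exact: u_convex p _ _ (in_setT (ln a : R^o)) (in_setT (ln c : R^o)).
rewrite -blac !lnK ?posrE// => uconv.
rewrite -[a ^+ j * _]/(w a) -[c ^+ j * _]/(w c).
set m := minr _ _.
have m0 : 0 < m by rewrite /m lt_min !w0.
have ma : ln m <= ln (w a) by rewrite ler_ln ?posrE ?w0// ge_min lexx.
have mc : ln m <= ln (w c) by rewrite ler_ln ?posrE ?w0// ge_min lexx orbT.
rewrite -ler_ln ?posrE ?w0// [leRHS]lnw// blac.
move: ma mc; rewrite !lnw// => ma mc.
have l10 : 0 <= 1 - l by rewrite subr_ge0.
have := ler_wpM2l l0 ma; have := ler_wpM2l l10 mc.
lra.
Qed.

(** Take the least J for which s^J u(s) is maximal over ]0, t] at s = t. If
    J = j + 1, then j fails, so t^j u(t) is already smaller than an earlier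
    value, and by quasiconcavity it bounds all later values of s^j u(s). This
    integer argument plays the role of a supporting line of - ln u(e^x) at
    x = ln t; rounding its slope costs the extra factor t. *)
Lemma assoc_seq_near_optimal t : 1 <= t ->
  u t = 1 \/ exists j, M j <= t ^+ j.+1 * u t.
Proof.
move=> t1; have t0 := lt_le_trans ltr01 t1; have t0' := ltW t0.
have ut0 := weight_gt0 (weightP u) t0'.
pose P J := `[< forall s, 0 < s -> s <= t -> s ^+ J * u s <= t ^+ J * u t >].
have tt2 : t < 2 * t by rewrite ltr_pMl// ltr1n.
(* By quasiconcavity it is enough to make s^J u(s) larger at 2 t than at t,
   which 2^J achieves. *)
have exP : exists J, P J.
  have u2t0 : 0 < u (2 * t) by rewrite (weight_gt0 (weightP u))// mulr_ge0.
  have [J uJ] : exists J : nat, u t < 2 ^+ J * u (2 * t).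
    exists (truncn (u t / u (2 * t))).+1; rewrite -ltr_pdivrMr//.
    apply: lt_trans (truncnS_gt _) _.
    by rewrite -natrX ltr_nat ltn_expl.
  exists J; apply/asboolP => s s0; rewrite le_eqVlt => /orP[/eqP->//|st].
  have := convex_weight_quasiconcave J s0 st tt2.
  rewrite ge_min => /orP[//|]; rewrite leNgt exprMn mulrAC [_ * u t]mulrC.
  by rewrite ltr_pM2r ?exprn_gt0// uJ.
case: (ex_minnP exP) => -[|j] /asboolP Pj minJ.
  left; apply/eqP; rewrite eq_le weight_le1//=.
  by have := Pj 1 ltr01 t1; rewrite !mul1r u_normalized ?ler01.
right; exists j.
have /asboolPn/existsNP[s0 /not_implyP[s00 /not_implyP[]]] : ~~ P j.
  by apply/negP => /minJ; rewrite ltnn.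
rewrite le_eqVlt => /orP[/eqP->//|s0t /negP]; rewrite -ltNge => us0.
have tjt : t ^+ j * u t <= t ^+ j.+1 * u t.
  by rewrite ler_pM2r// ler_weXn2l.
have u1 : 1 <= t ^+ j.+1 * u t.
  by have := Pj 1 ltr01 t1; rewrite expr1n mul1r u_normalized ?ler01.
apply: assoc_seq_le => s s_gt0.
have us_gt0 := weight_gt0 (weightP u) (ltW s_gt0).
have [s1|s1] := leP s 1.
  apply: le_trans u1; rewrite -[leRHS]mulr1 ler_pM ?exprn_ge0 ?(ltW us_gt0)//.
  - exact: ltW.
  - by rewrite exprn_ile1// ltW.
  - by rewrite weight_le1// ltW.
have [st|ts] := leP s t.
  apply: le_trans (Pj s s_gt0 st).
  by rewrite ler_pM2r// ler_weXn2l// ltW.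
apply: le_trans tjt.
have := convex_weight_quasiconcave j s00 s0t ts.
by rewrite ge_min leNgt us0.
Qed.

(** The bound M_j <= t^(j+1) u(t) has one power of t too many; comparing u(H t)
    with M_(2j+2) instead of M_2j cancels both copies of it, at the price of
    the constant M_2. *)
Lemma assoc_seq_mg_moderate_growth : assoc_seq_mg -> moderate_growth u.
Proof.
move=> [C C1 MC]; pose H := Num.max (C ^+ 2) (M 2).
have C2H : C ^+ 2 <= H by rewrite le_max lexx.
have M2H : M 2 <= H by rewrite le_max lexx orbT.
have H1 : 1 <= H by apply: le_trans C2H; rewrite exprn_ege1.
have eH : H <= expR H by apply: le_trans (expR_ge1Dx H); rewrite lerDr ler01.
have H0 := lt_le_trans ltr01 H1.
exists H => // t t0; have Ht0 : 0 <= H * t by rewrite mulr_ge0// ltW.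
have trivial_bound : u t = 1 -> u (H * t) <= expR H * u t ^+ 2.
  move=> ->; rewrite expr1n mulr1 (le_trans (weight_le1 Ht0))//.
  exact: le_trans eH.
have [t1|t1] := leP t 1; first exact/trivial_bound/u_normalized.
have [|[j Mj]] := assoc_seq_near_optimal (ltW t1); first exact: trivial_bound.
have t_gt0 := lt_trans ltr01 t1.
have ut0 := weight_gt0 (weightP u) t0.
pose n := j.+1.
have M0 k : 0 <= M k by exact/ltW/assoc_seq_gt0.
have C0 : 0 <= C by exact: le_trans C1.
have Mn : M (2 * n)%N <= (C ^+ 2) ^+ (2 * n) * M 2 * (t ^+ n * u t) ^+ 2.
  rewrite (_ : (2 * n)%N = (2 + (j + j))%N); last by rewrite /n mul2n doubleS addnn.
  apply: le_trans (MC 2%N (j + j)%N) _; set N := (2 + (j + j))%N.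
  rewrite mulrAC [leRHS]mulrAC ler_wpM2r//.
  apply: (@le_trans _ _ (C ^+ N * (C ^+ N * M j * M j))).
    rewrite ler_wpM2l ?exprn_ge0// (le_trans (MC j j))//.
    by rewrite !ler_wpM2r// ler_weXn2l// leq_addl.
  have -> : C ^+ N * (C ^+ N * M j * M j) = (C ^+ 2) ^+ N * M j ^+ 2.
    by rewrite [in RHS]exprAC; ring.
  by rewrite ler_wpM2l ?exprn_ge0// lerXn2r ?nnegrE// (le_trans (M0 j)).
have : (H * t) ^+ (2 * n) * u (H * t) <= M (2 * n)%N by exact: le_assoc_seq_ge0.
move=> /le_trans/(_ Mn).
have -> : (C ^+ 2) ^+ (2 * n) * M 2 * (t ^+ n * u t) ^+ 2 =
    t ^+ (2 * n) * ((C ^+ 2) ^+ (2 * n) * (M 2 * u t ^+ 2)).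
  by rewrite [t ^+ (2 * n)]exprM [t ^+ 2 ^+ n]exprAC; ring.
rewrite exprMn [_ * t ^+ _]mulrC -mulrA ler_pM2l ?exprn_gt0// => uHt.
rewrite -(ler_pM2l (exprn_gt0 (2 * n) H0)) (le_trans uHt)//.
apply: ler_pM; rewrite ?mulr_ge0 ?exprn_ge0 ?(ltW ut0)//.
  by rewrite lerXn2r ?nnegrE ?exprn_ge0// (ltW H0).
by rewrite ler_wpM2r ?exprn_ge0 ?(ltW ut0)// (le_trans M2H).
Qed.
End convex.
End normalized.
End associated_sequence.

(** * Products in weighted spaces *)

Section weighted_products.
Variable R : realType.
Implicit Types u v w : weight R.

Lemma moderate_growth_mul u H :
  (forall t, 0 <= t -> u (H * t) <= expR H * u t ^+ 2) -> 0 <= H ->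
  forall r s t, 0 <= s -> 0 <= t -> H * s <= r -> H * t <= r ->
  u r <= expR H * (u s * u t).
Proof.
move=> uH H0 r s t; wlog st : s t / s <= t.
  move=> ih s0 t0 sr tr; have [st|/ltW ts] := leP s t; first exact: ih.
  by rewrite [u s * _]mulrC; exact: ih.
move=> s0 t0 _ tr; have Ht0 := mulr_ge0 H0 t0.
apply: le_trans (weight_nonincr (weightP u) Ht0 tr) _.
apply: le_trans (uH _ t0) _; rewrite ler_wpM2l ?expR_ge0//.
rewrite ler_wpM2r// ?(ltW (weight_gt0 (weightP u) t0))//.
exact: (weight_nonincr (weightP u)).
Qed.

Lemma entireM (f g : R[i]^o -> R[i]^o) :
  entire f -> entire g -> entire (f \* g).
Proof. by move=> ef eg z; exact: derivableM. Qed.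

Section bound.
Variables (v w1 w2 : weight R) (K : R).
Hypothesis K0 : 0 <= K.
Hypothesis vw : forall t, 0 <= t -> v t <= K * (w1 t * w2 t).

Lemma normcM_weight_le (f g : R[i]^o -> R[i]^o) z :
  normc ((f \* g) z) * v (normc z) <=
  K * ((normc (f z) * w1 (normc z)) * (normc (g z) * w2 (normc z))).
Proof.
rewrite -[(f \* g) z]/((f z : R[i]) * g z) normcM.
apply: le_trans (ler_wpM2l _ (vw (normc_ge0 z))) _.
  by rewrite mulr_ge0 ?normc_ge0.
by rewrite le_eqVlt; apply/predU1P; left; ring.
Qed.

Lemma Hinf_predM f g :
  f \in Hinf_pred w1 -> g \in Hinf_pred w2 -> f \* g \in Hinf_pred v.
Proof.
move=> /HinfP[ef [A fA]] /HinfP[eg [B gB]]; apply/HinfP.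
split; first exact: entireM.
exists (K * (A * B)) => _ [z _ <-]; apply: le_trans (normcM_weight_le _ _ _) _.
have p0 (w : weight R) (x : R[i]) : 0 <= normc x * w (normc z).
  by rewrite mulr_ge0 ?normc_ge0// ltW// weight_normc_gt0.
by rewrite ler_wpM2l// ler_pM//; [apply: fA|apply: gB]; exists z.
Qed.

Lemma wnormM_le (f : Hinf w1) (g : Hinf w2) (h : Hinf v) :
  val h = val f \* val g -> wnorm h <= K * (wnorm f * wnorm g).
Proof.
move=> hfg; apply: wnorm_le => z; rewrite hfg.
apply: le_trans (normcM_weight_le _ _ _) _.
have p0 (w : weight R) (x : R[i]) : 0 <= normc x * w (normc z).
  by rewrite mulr_ge0 ?normc_ge0// ltW// weight_normc_gt0.
by rewrite ler_wpM2l// ler_pM// le_wnorm.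
Qed.
End bound.

Lemma wnormN v (f : Hinf v) : wnorm (- f) = wnorm f.
Proof. by rewrite -scaleN1r wnormZ normcN normc1 mul1r. Qed.

Lemma gt0_complex (e : R[i]) : 0 < e -> exists2 r : R, 0 < r & e = (r%:C)%C.
Proof. by case: e => a b; rewrite ltcE/= => /andP[/eqP-> a0]; exists a. Qed.

(** The norm of [Hinf v] takes its values in R[i]; this lemma and [cvg_wnormP]
    allow real radii in its topology. *)
Lemma nbhs0_wnormP v (A : set (Hinf v)) :
  nbhs (0 : Hinf v) A <->
  exists2 e : R, 0 < e & forall f, wnorm f <= e -> A f.
Proof.
split.
  move=> /nbhs_norm0P[e /gt0_complex[r r0 ->{e}] rA].
  exists (r / 2) => [|f fr]; first by rewrite divr_gt0.
  apply: rA => /=; rewrite -[`|f|]/((wnorm f)%:C%C) ltcR.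
  by rewrite (le_lt_trans fr)// gtr_pMr// invf_lt1// ltr1n.
move=> [e e0 eA]; apply/nbhs_norm0P; exists (e%:C%C); first by rewrite /= ltcR.
by move=> f /= fe; apply: eA; move: fe; rewrite -[`|f|]/((wnorm f)%:C%C) ltcR => /ltW.
Qed.

Lemma cvg_wnormP v (T : Type) (F : set_system T) {FF : Filter F}
    (f : T -> Hinf v) (l : Hinf v) :
  f x @[x --> F] --> l <->
  forall e : R, 0 < e -> \forall x \near F, wnorm (l - f x) <= e.
Proof.
apply: (iff_trans (@cvgrPdist_le _ (Hinf v) _ F _ f l)); split=> fl e.
  rewrite -(@ltcR R) => /fl.
  by apply: filterS => x; rewrite -[`|_|]/((wnorm _)%:C%C) lecR.
move=> /gt0_complex[r /fl + ->].
by apply: filterS => x; rewrite -[`|_|]/((wnorm _)%:C%C) lecR.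
Qed.

End weighted_products.

(** * Continuity on the inductive limit *)

Section inductive_limit_multiplication.
Variables (R : realType) (u : weight R).
Variable H : R.
Hypothesis H1 : 1 <= H.
Hypothesis uH : forall t, 0 <= t -> u (H * t) <= expR H * u t ^+ 2.
Let H0 : 0 <= H := le_trans ler01 H1.

(** A step whose dilation factor is at least H times that of step c. *)
Definition dilation_index (c : nat) : nat := truncn (H * c.+1%:R).

Lemma dilation_index_ge c : H * c.+1%:R <= (dilation_index c).+1%:R.
Proof. exact/ltW/truncnS_gt. Qed.

Lemma ind_step_mul_le c d : forall t, 0 <= t ->
  ind_step u (dilation_index (maxn c d)) t <=
  expR H * (ind_step u c t * ind_step u d t).
Proof.
move=> t t0; apply: (moderate_growth_mul uH H0); rewrite /= ?mulr_ge0//.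
all: rewrite mulrA ler_wpM2r// (le_trans _ (dilation_index_ge _))//.
all: by rewrite ler_wpM2l// ler_nat ltnS ?leq_maxl ?leq_maxr.
Qed.

Lemma Hind_mul_closed : mul_closed (Hind_pred u).
Proof.
move=> f g /HindP[c fc] /HindP[d gd]; apply/HindP.
exists (dilation_index (maxn c d)).
exact: (Hinf_predM (expR_ge0 H) (ind_step_mul_le c d) fc gd).
Qed.

Variable mP : mul_closed (Hind_pred u).
Let mul (f g : Hind u) : Hind u := mul_op mP (f, g).

Let mulC f g : mul f g = mul g f.
Proof. by apply/val_inj/funext => z; exact: mulrC. Qed.

Let mulDl f1 f2 g : mul (f1 + f2) g = mul f1 g + mul f2 g.
Proof. by apply/val_inj/funext => z; exact: mulrDl. Qed.

Let mulDr f g1 g2 : mul f (g1 + g2) = mul f g1 + mul f g2.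
Proof. by apply/val_inj/funext => z; exact: mulrDr. Qed.

Let mulZl a f g : mul (a *: f) g = a *: mul f g.
Proof. by apply/val_inj/funext => z; exact/esym/mulrA. Qed.

(** V contains a ball of radius eps_c in each step c. With
    delta_c = min(1, e^-H eps_d), d = dilation_index c, one has
    delta_c delta_c' <= delta_max(c, c'), so V contains the products of the
    balls of radii delta_c and delta_c'. The hull W of these balls is taken as
    the intersection of all absolutely convex sets that contain them: products
    extend from the balls to W in one factor at a time, because the set of f
    with f g in V is absolutely convex. *)
Lemma ind_nbhs0_mul V : ind_nbhs0 V ->
  exists2 W, ind_nbhs0 W & forall f g, W f -> W g -> V (mul f g).
Proof.
move=> [aV nV].
have /choice[eps epsP] : forall c, exists e : R, 0 < e /\
    forall f : Hinf (ind_step u c), wnorm f <= e -> V (ind_incl f).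
  by move=> c; have /nbhs0_wnormP[e e0 eV] := nV c; exists e.
pose delta c := Num.min 1 (eps (dilation_index c) / expR H).
have delta0 c : 0 < delta c.
  by rewrite lt_min ltr01 divr_gt0 ?expR_gt0//; have [] := epsP (dilation_index c).
have delta_mul c d (f : Hinf (ind_step u c)) (g : Hinf (ind_step u d)) :
    wnorm f <= delta c -> wnorm g <= delta d -> V (mul (ind_incl f) (ind_incl g)).
  move=> fc gd; pose k := dilation_index (maxn c d).
  have hk : val f \* val g \in Hinf_pred (ind_step u k).
    exact: (Hinf_predM (expR_ge0 H) (ind_step_mul_le c d) (valP f) (valP g)).
  pose h : Hinf (ind_step u k) := Sub (val f \* val g) hk.
  have -> : mul (ind_incl f) (ind_incl g) = ind_incl h by exact/val_inj.
  have [_] := epsP k; apply.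
  apply: (le_trans
    (wnormM_le (expR_ge0 H) (ind_step_mul_le c d) (erefl : val h = _))).
  rewrite mulrC -ler_pdivlMr ?expR_gt0//.
  apply: (le_trans (ler_pM (wnorm_ge0 f) (wnorm_ge0 g) fc gd)).
  apply: (@le_trans _ _ (delta (maxn c d))); last by rewrite ge_min lexx orbT.
  rewrite /maxn; case: ifP => _.
    by rewrite ler_piMl ?ge_min ?lexx// ltW.
  by rewrite ler_piMr ?ge_min ?lexx// ltW.
pose W := [set f | forall A : set (Hind u), absolutely_convex A ->
  (forall c (f : Hinf (ind_step u c)), wnorm f <= delta c -> A (ind_incl f)) ->
  A f].
exists W.
  split.
    move=> a b f g ab Wf Wg A aA hA; apply: (aA) => //; [exact: Wf|exact: Wg].
  move=> c; apply/nbhs0_wnormP; exists (delta c) => // f fc A _; exact.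
have aVmul g : absolutely_convex [set f | V (mul f g)].
  by move=> a b f1 f2 ab V1 V2 /=; rewrite mulDl !mulZl; exact: aV.
move=> f g Wf Wg; apply: (Wf [set f | V (mul f g)]) => // c f' f'c.
rewrite /= mulC; apply: (Wg [set g | V (mul g _)]) => // d g' g'd.
by rewrite /= mulC; exact: delta_mul.
Qed.

(** Continuity at (f0, g0) follows from f g - f0 g0 =
    f0 (g - g0) + g0 (f - f0) + (f - f0) (g - g0): a fixed factor f0 lies in a
    multiple of W, so that multiplication by it is also controlled by W. *)
Lemma Hind_mul_continuous : continuous (mul_op mP : Hind u * Hind u -> Hind u).
Proof.
move=> [f0 g0] /= U [V nV VU].
have [W nW WV] := ind_nbhs0_mul (ind_nbhs0Z 2 (ind_nbhs0Z 2 nV)).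
have Vsum a b c : V (2 *: (2 *: a)) -> V (2 *: (2 *: b)) -> V (2 *: (2 *: c)) ->
    V (a + (b + c)).
  move=> Va Vb Vc; apply: ind_nbhs0_half => //.
    have := ind_nbhs0_balanced (a := 2^-1) nV _ Va; rewrite scaler_half; apply.
    by rewrite ger0_norm ?invr_ge0// invf_le1// ler1n.
  by rewrite scalerDr; exact: ind_nbhs0_half.
have fixed h0 : exists2 W', ind_nbhs0 W' &
    forall h, W' h -> V (2 *: (2 *: mul h0 h)).
  have [e e0 eW] := ind_nbhs0_absorbing h0 nW.
  exists [set h | W (e^-1 *: h)] => [|h Wh]; first exact: ind_nbhs0Z.
  have -> : mul h0 h = mul (e *: h0) (e^-1 *: h).
    by rewrite mulZl [in RHS]mulC mulZl scalerA divff ?scale1r 1?mulC// gt_eqF.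
  by apply: WV => //; apply: eW; rewrite gtr0_norm.
have [W1 nW1 W1V] := fixed f0; have [W2 nW2 W2V] := fixed g0.
exists ([set f | (W `&` W2) (f - f0)], [set g | (W `&` W1) (g - g0)]) => /=.
  split; first exact: (ind_nbhs_shift f0 (ind_nbhs0I nW nW2)).
  exact: (ind_nbhs_shift g0 (ind_nbhs0I nW nW1)).
move=> [f g] /= [[Wf W2f] [Wg W1g]].
have -> : mul_op mP (f, g) =
    mul f0 g0 + (mul f0 (g - g0) + (mul g0 (f - f0) + mul (f - f0) (g - g0))).
  rewrite -[LHS]/(mul f g) [mul g0 _]mulC -mulDr [g0 + _]addrC subrK addrA.
  by rewrite -mulDr [g0 + _]addrC subrK -mulDl [f0 + _]addrC subrK.
by apply: VU; apply: Vsum; [exact: W1V|exact: W2V|exact: WV].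
Qed.

End inductive_limit_multiplication.

(** * Continuity on the projective limit *)

Section limits.

Lemma cvg_initial_topology (S : choiceType) (T : topologicalType) (w : S -> T)
    (X : Type) (F : set_system X) {FF : Filter F}
    (f : X -> initial_topology w) (l : initial_topology w) :
  w (f x) @[x --> F] --> w l -> f x @[x --> F] --> l.
Proof.
move=> wfl U [_ /= [[W oW <-]] /= Wl /filterS]; apply.
by apply: wfl; exact: open_nbhs_nbhs.
Qed.

Lemma cvg_prod_topology (I : Type) (T : I -> topologicalType)
    (X : Type) (F : set_system X) {FF : Filter F}
    (f : X -> prod_topology T) (l : prod_topology T) :
  (forall i, f x i @[x --> F] --> l i) -> f x @[x --> F] --> l.
Proof.
move=> fl; apply/cvg_sup => i; exact: cvg_initial_topology.
Qed.
End limits.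

Section projective_limit_multiplication.
Variables (R : realType) (u : weight R).

Definition proj_comp (c : nat) (f : Hproj u) : Hinf (proj_step u c) :=
  proj_diag f c.

Lemma cvg_Hproj (X : Type) (F : set_system X) {FF : Filter F}
    (f : X -> Hproj u) (l : Hproj u) :
  (forall c, proj_comp c (f x) @[x --> F] --> proj_comp c l) ->
  f x @[x --> F] --> l.
Proof.
move=> fl; apply: cvg_initial_topology; exact: cvg_prod_topology.
Qed.

Lemma proj_comp_continuous c : continuous (@proj_comp c).
Proof.
move=> f; apply: (@continuous_comp _ _ _ (@proj_diag R u) (fun g => g c)).
  exact: initial_continuous.
exact: (@proj_continuous nat (fun c => Hinf (proj_step u c)) c).
Qed.

Section moderate_growth.
Variable H : R.
Hypothesis H1 : 1 <= H.
Hypothesis uH : forall t, 0 <= t -> u (H * t) <= expR H * u t ^+ 2.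
Let H0 : 0 <= H := le_trans ler01 H1.

Lemma proj_step_mul_le c : forall t, 0 <= t ->
  proj_step u c t <=
  expR H * (proj_step u (dilation_index H c) t *
            proj_step u (dilation_index H c) t).
Proof.
move=> t t0; set d := dilation_index H c.
have Ht : H * (d.+1%:R^-1 * t) <= c.+1%:R^-1 * t.
  rewrite mulrA ler_wpM2r// ler_pdivrMr// mulrC ler_pdivlMr//.
  exact: dilation_index_ge.
by apply: (moderate_growth_mul uH H0) => //=; rewrite mulr_ge0 ?invr_ge0.
Qed.

Lemma Hproj_mul_closed : mul_closed (Hproj_pred u).
Proof.
move=> f g /HprojP fP /HprojP gP; apply/HprojP => c.
exact: (Hinf_predM (expR_ge0 H) (proj_step_mul_le c) (fP _) (gP _)).
Qed.

Variable mP : mul_closed (Hproj_pred u).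

Lemma Hproj_mul_continuous :
  continuous (mul_op mP : Hproj u * Hproj u -> Hproj u).
Proof.
move=> [f0 g0]; apply: cvg_Hproj => c; apply/cvg_wnormP => e e0.
pose d := dilation_index H c; pose K := expR H.
have K0 : 0 < K := expR_gt0 H.
pose P (x y : Hinf (proj_step u d)) : Hinf (proj_step u c) :=
  Sub (val x \* val y)
    (Hinf_predM (expR_ge0 H) (proj_step_mul_le c) (valP x) (valP y)).
have P_le x y : wnorm (P x y) <= K * (wnorm x * wnorm y).
  exact: (wnormM_le (expR_ge0 H) (proj_step_mul_le c)).
set F0 := proj_comp d f0; set G0 := proj_comp d g0.
pose S := wnorm F0 + wnorm G0 + 1.
have S0 : 0 < S by rewrite ltr_wpDl// addr_ge0// wnorm_ge0.
pose delta := Num.min 1 (e / (K * S)).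
have delta0 : 0 < delta by rewrite lt_min ltr01 divr_gt0 ?mulr_gt0.
have cvg_f : proj_comp d fg.1 @[fg --> (f0, g0)] --> F0.
  apply: (cvg_comp fst (proj_comp d)); first exact: cvg_fst.
  exact: proj_comp_continuous.
have cvg_g : proj_comp d fg.2 @[fg --> (f0, g0)] --> G0.
  apply: (cvg_comp snd (proj_comp d)); first exact: cvg_snd.
  exact: proj_comp_continuous.
apply: filterS2 ((cvg_wnormP _ _).1 cvg_f _ delta0)
  ((cvg_wnormP _ _).1 cvg_g _ delta0) => -[f g] /=.
set F := proj_comp d f; set G := proj_comp d g => Fd Gd.
have -> : proj_comp c (mul_op mP (f0, g0)) - proj_comp c (mul_op mP (f, g)) =
    P (F0 - F) G0 + P F0 (G0 - G) - P (F0 - F) (G0 - G).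
  apply/val_inj/funext => z.
  rewrite -[LHS]/(val f0 z * val g0 z - val f z * val g z).
  rewrite -[RHS]/((val f0 z - val f z) * val g0 z
    + val f0 z * (val g0 z - val g z)
    - (val f0 z - val f z) * (val g0 z - val g z)).
  ring.
apply: le_trans (wnormD _ _) _; rewrite wnormN.
apply: le_trans (lerD (wnormD _ _) (lexx _)) _.
apply: le_trans (lerD (lerD (P_le _ _) (P_le _ _)) (P_le _ _)) _.
apply: (@le_trans _ _
  (K * (delta * wnorm G0) + K * (wnorm F0 * delta) + K * (delta * 1))).
  have Gd1 : wnorm (G0 - G) <= 1 by rewrite (le_trans Gd)// ge_min lexx.
  by apply: lerD; [apply: lerD|]; rewrite (ler_pM2l K0); apply: ler_pM => //;
    exact: wnorm_ge0.
rewrite (_ : _ + _ = delta * (K * S)); last by rewrite /S; ring.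
by rewrite -ler_pdivlMr ?mulr_gt0// ge_min lexx orbT.
Qed.
End moderate_growth.
End projective_limit_multiplication.

(** * Monomials with large products *)

Section monomials.
Variables (R : realType) (u : weight R).
Hypothesis u_normalized : normalized u.
Local Notation M := (assoc_seq u).

Lemma normcX (z : R[i]) n : normc (z ^+ n) = normc z ^+ n.
Proof. by elim: n => [|n ih]; rewrite ?normc1// !exprS normcM ih. Qed.

Lemma normc_real (a : R) : 0 <= a -> normc (a%:C)%C = a.
Proof. by move=> a0; rewrite /normc/= expr0n addr0 sqrtr_sqr ger0_norm. Qed.

Definition monomial (a : R) (j : nat) : R[i]^o -> R[i]^o :=
  fun z => ((a%:C)%C * (z : R[i]) ^+ j : R[i]).

Lemma entire_monomial a j : entire (monomial a j).
Proof.
move=> z; apply: (@derivableZ _ _ _ (fun z : R[i]^o => (z : R[i]) ^+ j : R[i]^o)).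
exact: (@exprn_derivable R[i] j z 1).
Qed.

Lemma normc_monomial a j z : 0 <= a -> normc (monomial a j z) = a * normc z ^+ j.
Proof. by move=> a0; rewrite /monomial normcM normcX normc_real. Qed.

(** Dilating u by d turns the norm M_j of z^j into d^-j M_j; the factor (m + 1)^j
    makes up for d^-j as soon as d^-1 <= m + 1, and one more factor m + 1 makes
    the norms tend to zero for any choice of exponents. *)
Definition scaled_monomial (m j : nat) : R[i]^o -> R[i]^o :=
  monomial (m.+1%:R ^+ j.+1 * M j)^-1 j.

Let scale_ge0 (m j : nat) : 0 <= (m.+1%:R ^+ j.+1 * M j)^-1 :> R.
Proof. by rewrite ltW// invr_gt0 mulr_gt0 ?exprn_gt0 ?assoc_seq_gt0. Qed.

Let scale_gt0 (m j : nat) : 0 < (m.+1%:R ^+ j.+1 * M j)^-1 :> R.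
Proof. by rewrite invr_gt0 mulr_gt0 ?exprn_gt0 ?assoc_seq_gt0. Qed.

Lemma scaled_monomial_le (d : {posnum R}) m j z : d%:num^-1 <= m.+1%:R ->
  normc (scaled_monomial m j z) * dilate d u (normc z) <= m.+1%:R^-1.
Proof.
move=> dm; rewrite normc_monomial//=; set t := normc z.
have t0 : 0 <= t := normc_ge0 z.
have N0 : 0 < m.+1%:R :> R by [].
have M0 := assoc_seq_gt0 u_normalized j.
have tM : t ^+ j * u (d%:num * t) <= m.+1%:R ^+ j * M j.
  have -> : t ^+ j = d%:num^-1 ^+ j * (d%:num * t) ^+ j.
    by rewrite -exprMn mulrA mulVf ?mul1r.
  rewrite -mulrA; apply: (@le_trans _ _ (d%:num^-1 ^+ j * M j)).
    by rewrite ler_pM2l ?exprn_gt0// le_assoc_seq_ge0// mulr_ge0.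
  by rewrite ler_wpM2r ?(ltW M0)// lerXn2r ?nnegrE.
rewrite -mulrA ler_pdivrMl ?mulr_gt0 ?exprn_gt0//.
by rewrite exprS [leRHS]mulrC !mulrA mulVf ?mul1r.
Qed.

Lemma scaled_monomial_Hinf (d : {posnum R}) m j :
  scaled_monomial m j \in Hinf_pred (dilate d u).
Proof.
have M0 := assoc_seq_gt0 u_normalized j.
apply/HinfP; split; first exact: entire_monomial.
exists ((m.+1%:R ^+ j.+1 * M j)^-1 * (d%:num^-1 ^+ j * M j)) => _ [z _ <-].
rewrite normc_monomial// -mulrA ler_pM2l//=.
have -> : normc z ^+ j = d%:num^-1 ^+ j * (d%:num * normc z) ^+ j.
  by rewrite -exprMn mulrA mulVf ?mul1r.
by rewrite -mulrA ler_pM2l ?exprn_gt0// le_assoc_seq_ge0// mulr_ge0// normc_ge0.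
Qed.

(** The exponents come from the failure of the condition on M with both
    constants equal to (m + 1)^2: of the factor (m + 1)^(2 (j + k + 1)) gained in
    this way, (m + 1)^(j + k + 2) pays for the scaling of the two monomials and
    (m + 1)^(j + k) for the dilation of u. At s = (m + 1) t_m the value
    s^(j+k) u(s), like its supremum M_(j+k), is beyond the resulting bound. *)
Lemma not_assoc_seq_mg : ~ assoc_seq_mg u ->
  exists j k : nat -> nat, exists2 t : nat -> R, forall m, 0 < t m &
  forall m, 1 < normc
    ((scaled_monomial m (j m) \* scaled_monomial m (k m)) ((t m)%:C)%C) *
    u (m.+1%:R * t m).
Proof.
move=> notmg.
suff /choice[jkt jktP] : forall m : nat, exists jkt : nat * nat * R,
    0 < jkt.2 /\
    1 < normc ((scaled_monomial m jkt.1.1 \* scaled_monomial m jkt.1.2)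
                 ((jkt.2)%:C)%C) * u (m.+1%:R * jkt.2).
  exists (fun m => (jkt m).1.1), (fun m => (jkt m).1.2).
  by exists (fun m => (jkt m).2) => m; have [] := jktP m.
move=> m; pose N : R := m.+1%:R.
have N0 : 0 < N by rewrite ltr0n.
have N1 : 1 <= N by rewrite ler1n.
have [j [k]] : exists j k, N ^+ (2 * (j + k).+1) * M j * M k < M (j + k)%N.
  apply: contra_notP notmg => noex.
  apply: (@assoc_seq_mg_const _ _ u_normalized (N ^+ 2) (N ^+ 2)); rewrite ?exprn_ege1//.
  move=> j k; rewrite -exprS -exprM leNgt; apply/negP => h.
  by apply: noex; exists j, k.
move=> /assoc_seq_gt[s s0 us]; exists (j, k, s / N) => /=.
have t0 : 0 < s / N by rewrite divr_gt0.
split=> //.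
rewrite /= normcM !normc_monomial// normc_real ?(ltW t0)//.
have -> : N * (s / N) = s by rewrite mulrCA divff ?mulr1// gt_eqF.
rewrite -/N.
have Mj := assoc_seq_gt0 u_normalized j; have Mk := assoc_seq_gt0 u_normalized k.
have -> : (N ^+ j.+1 * M j)^-1 * (s / N) ^+ j *
    ((N ^+ k.+1 * M k)^-1 * (s / N) ^+ k) * u s =
    (s ^+ (j + k) * u s) / (N ^+ (2 * (j + k).+1) * M j * M k).
  rewrite !expr_div_n [(2 * _)%N]mulnC exprM ![N ^+ _.+1]exprS !exprD.
  by field; rewrite !gt_eqF ?exprn_gt0.
by rewrite ltr_pdivlMr ?mul1r// !mulr_gt0 ?exprn_gt0.
Qed.

End monomials.

(** * Continuity forces the growth of the associated sequence *)

Section necessity.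
Variables (R : realType) (u : weight R).
Hypothesis u_normalized : normalized u.

Lemma cvg_scaled_monomial (d : {posnum R}) (j : nat -> nat)
    (f : nat -> Hinf (dilate d u)) :
  (forall m, val (f m) = scaled_monomial u m (j m)) -> f m @[m --> \oo] --> 0.
Proof.
move=> fE; apply/cvg_wnormP => e e0.
have [m0 _ m0d] := near_infty_natSinv_lt d.
have [m1 _ m1e] := near_infty_natSinv_lt (PosNum e0).
exists (maxn m0 m1) => // m /=; rewrite geq_max => /andP[mm0 mm1].
rewrite sub0r wnormN; apply: le_trans (ltW (m1e _ mm1)).
apply: wnorm_le => z; rewrite fE; apply: scaled_monomial_le => //.
by rewrite -[leRHS]invrK lef_pV2 ?posrE// ltW//; exact: m0d.
Qed.

Definition spike_set (t : nat -> R) : set (Hind u) :=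
  [set h | forall m, normc (val h ((t m)%:C)%C) * u (m.+1%:R * t m) <= 1].

(** On the unit ball of step c, the conditions of index m >= c hold because
    u((m+1) t_m) <= u((c+1) t_m). Only finitely many conditions remain, and each
    holds on a smaller ball. *)
Lemma ind_nbhs0_spike_set (t : nat -> R) :
  (forall m, 0 < t m) -> ind_nbhs0 (spike_set t).
Proof.
move=> t0.
have uge0 m s : 0 <= u (m.+1%:R * t s).
  by apply/ltW/(weight_gt0 (weightP u)); rewrite mulr_ge0// ltW.
split.
  move=> a b f g; rewrite -[`|a|]/((normc a)%:C%C) -[`|b|]/((normc b)%:C%C).
  rewrite -rmorphD/= (@lecR _ _ 1) => ab fV gV m.
  rewrite -[val _ _]/(a * val f _ + b * val g _).
  apply: le_trans (ler_wpM2r (uge0 _ _) (normcD _ _)) _.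
  rewrite !normcM mulrDl -!mulrA; apply: le_trans ab.
  by apply: lerD; rewrite ler_piMr ?normc_ge0// ?fV ?gV.
move=> c; apply/nbhs0_wnormP.
have vc0 m : 0 < u (c.+1%:R * t m).
  by apply: (weight_gt0 (weightP u)); rewrite mulr_ge0// ltW.
(* The sum bounds 1 and each of the finitely many inverses at once. *)
pose S := 1 + \sum_(m < c) (u (c.+1%:R * t m))^-1.
have S1 : 1 <= S by rewrite lerDl sumr_ge0// => m _; rewrite invr_ge0 ltW.
have S0 : 0 < S := lt_le_trans ltr01 S1.
exists S^-1 => [|f fS m]; first by rewrite invr_gt0.
have tm : normc ((t m)%:C)%C = t m by rewrite normc_real// ltW.
have fc : normc (val f ((t m)%:C)%C) * u (c.+1%:R * t m) <= S^-1.
  by apply: le_trans fS; have := le_wnorm f ((t m)%:C)%C; rewrite tm.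
rewrite -[val (ind_incl f)]/(val f).
have [cm|mc] := leqP c m.
  apply: (@le_trans _ _ S^-1); last by rewrite invf_le1.
  apply: le_trans fc; rewrite ler_wpM2l ?normc_ge0//.
  apply: (weight_nonincr (weightP u)); first by rewrite mulr_ge0// ltW.
  by rewrite ler_wpM2r ?ler_nat// ltW.
apply: (@le_trans _ _ (normc (val f ((t m)%:C)%C))).
  by rewrite ler_piMr ?normc_ge0// weight_le1// mulr_ge0// ltW.
rewrite -ler_pdivlMr// in fc; apply: le_trans fc _.
rewrite mulrC ler_pdivrMr// mul1r /S (bigD1 (Ordinal mc))//= addrCA.
rewrite lerDl addr_ge0// sumr_ge0// => i _.
by rewrite invr_ge0 ltW.
Qed.

Lemma Hind_mul_assoc_seq_mg (mP : mul_closed (Hind_pred u)) :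
  continuous (mul_op mP : Hind u * Hind u -> Hind u) -> assoc_seq_mg u.
Proof.
move=> cm; apply: contrapT => /(not_assoc_seq_mg u_normalized)[j [k [t t0 tjk]]].
pose mono (i : nat -> nat) m : Hinf (ind_step u 0) :=
  Sub (scaled_monomial u m (i m)) (scaled_monomial_Hinf u_normalized _ _ _).
have cvg_mono i : ind_incl (mono i m) @[m --> \oo] --> (0 : Hind u).
  rewrite -(ind_incl0 u 0); apply: (cvg_comp (mono i) (@ind_incl _ u 0)).
    exact: (@cvg_scaled_monomial _ i).
  exact: ind_incl_continuous.
have mul00 : mul_op mP (0 : Hind u, 0 : Hind u) = 0 :> Hind u.
  by apply/val_inj/funext => z; exact: mulr0.
have cvg_prod :
    (mul_op mP (ind_incl (mono j m), ind_incl (mono k m)) : Hind u)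
      @[m --> \oo] --> (0 : Hind u).
  rewrite -mul00.
  exact: (cvg_comp _ _ (cvg_pair (cvg_mono j) (cvg_mono k))
    (cm (0 : Hind u, 0 : Hind u))).
have [m _ mV] := cvg_prod _ (ind_nbhs_shift _ (ind_nbhs0_spike_set t0)).
have : spike_set t (mul_op mP (ind_incl (mono j m), ind_incl (mono k m))).
  by have := mV m (leqnn m); rewrite /= subr0.
move=> /(_ m); rewrite leNgt.
by move/negP; apply; exact: tjk.
Qed.

Lemma Hproj_mul_assoc_seq_mg (mP : mul_closed (Hproj_pred u)) :
  continuous (mul_op mP : Hproj u * Hproj u -> Hproj u) -> assoc_seq_mg u.
Proof.
move=> cm; apply: contrapT => /(not_assoc_seq_mg u_normalized)[j [k [t t0 tjk]]].
have monoP m i : scaled_monomial u m i \in Hproj_pred u.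
  by apply/HprojP => c; exact: scaled_monomial_Hinf.
pose mono (i : nat -> nat) m : Hproj u :=
  Sub (scaled_monomial u m (i m)) (monoP _ _).
have zeroP : (0 : R[i]^o -> R[i]^o) \in Hproj_pred u.
  by apply/HprojP => c; exact: (rpred0 (Hinf_pred _)).
pose zero : Hproj u := Sub (0 : R[i]^o -> R[i]^o) zeroP.
have zeroE c : proj_comp c zero = 0 by exact/val_inj.
have cvg_mono i : mono i m @[m --> \oo] --> zero.
  apply: cvg_Hproj => c; rewrite zeroE.
  exact: (@cvg_scaled_monomial _ i).
have cvg_prod : mul_op mP (mono j m, mono k m) @[m --> \oo] -->
    (mul_op mP (zero, zero) : Hproj u).
  exact: (cvg_comp _ _ (cvg_pair (cvg_mono j) (cvg_mono k)) (cm (zero, zero))).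
have cvg0 : proj_comp 0 (mul_op mP (mono j m, mono k m)) @[m --> \oo] -->
    proj_comp 0 (mul_op mP (zero, zero)).
  exact: (cvg_comp _ _ cvg_prod (@proj_comp_continuous _ _ 0 _)).
have [m _ /(_ m (leqnn m))] := (cvg_wnormP _ _).1 cvg0 1 ltr01.
have -> : proj_comp 0 (mul_op mP (zero, zero)) = 0.
  by apply/val_inj/funext => z; exact: mulr0.
rewrite /= sub0r wnormN leNgt => /negP; apply.
apply: lt_le_trans (tjk m) _.
apply: le_trans (le_wnorm _ ((t m)%:C)%C).
rewrite ler_wpM2l ?normc_ge0// normc_real ?(ltW (t0 m))//=.
apply: (weight_nonincr (weightP u)).
  by rewrite mulr_ge0 ?invr_ge0// (ltW (t0 m)).
by rewrite ler_wpM2r ?(ltW (t0 m))// invr1 ler1n.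
Qed.

End necessity.

Theorem theorem4p13 (R : realType) (u : weight R)
    (u_normalized : normalized u) (u_convex : convex_weight u) :
  [<-> exists mP : mul_closed (Hind_pred u),
         continuous (mul_op mP : Hind u * Hind u -> Hind u);
       exists mP : mul_closed (Hproj_pred u),
         continuous (mul_op mP : Hproj u * Hproj u -> Hproj u);
       moderate_growth u;
       exists2 C : R, 1 <= C &
         forall j k : nat, assoc_seq u (j + k)%N <=
           C ^+ (j + k) * assoc_seq u j * assoc_seq u k].
Proof.
have mg : assoc_seq_mg u -> moderate_growth u.
  exact: assoc_seq_mg_moderate_growth.
tfae.
- move=> [mP cm]; have [H H1 uH] := mg (Hind_mul_assoc_seq_mg u_normalized cm).
  by exists (Hproj_mul_closed H1 uH); exact: Hproj_mul_continuous H1 uH _.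
- by move=> [mP cm]; exact/mg/(Hproj_mul_assoc_seq_mg u_normalized cm).
- exact: moderate_growth_assoc_seq_mg.
- move=> /mg[H H1 uH].
  by exists (Hind_mul_closed H1 uH); exact: Hind_mul_continuous H1 uH _.
Qed.
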